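(* For all kernels $v,w\in\mathcal{W}$ one has $\rho_{v}\circ\rho_{w}=\rho_{(A_{v}\circ A_{w})'}$ on $\mathcal{D}$, where the prime denotes the derivative; consequently $\rho_w\mapsto A_{w}$ is an isomorphism from the monoid $(\{\rho_{w}:w\in\mathcal{W}\},\circ)$ onto the monoid of absolutely continuous nondecreasing surjections of $[0,1]$ under composition. In particular, for every $w\in\mathcal{W}$, $f\in\mathcal{D}$ and $n\ge 1$, the $n$-fold iterate is again a derangetropy operator, $$\rho_{w}^{\,n}[f]=\big(A_{w}^{\circ n}\big)'(F)\,f=f\prod_{j=0}^{n-1}w\big(A_{w}^{\circ j}(F)\big).$$
   Context: $\mathcal{D}$ is the set of probability densities $f\in L^{1}(\mathbb{R})$, and $F(x)=\int_{-\infty}^{x}f$. $\mathcal{W}$ is the set of kernels, i.e. probability densities on $[0,1]$. For $w\in\mathcal{W}$, $\rho_{w}[f](x)=w(F(x))f(x)$ and $A_{w}(z)=\int_{0}^{z}w(s)\,ds$. $A^{\circ n}$ denotes $n$-fold composition. Densities and kernels are identified when equal almost everywhere. *)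

(* Defs.v *)
From HB Require Import structures.
From mathcomp Require Import all_boot all_order all_algebra.
From mathcomp Require Import all_classical all_reals all_analysis measurable_realfun.

Set Implicit Arguments.
Unset Strict Implicit.
Unset Printing Implicit Defensive.

Import Order.TTheory GRing.Theory Num.Theory.
Import numFieldNormedType.Exports.

Local Open Scope classical_set_scope.
Local Open Scope ring_scope.

(* Lebesgue measure on [0, 1], as the restriction to [0, 1] of the Lebesgue
   measure of the line: values outside [0, 1] are negligible for it. *)
Definition lebesgue01 (R : realType) : {measure set (measurableTypeR R) -> \bar R} :=
  mrestr lebesgue_measure (measurable_itv `[(0 : R), 1]).

Section pdf.
Context d (T : measurableType d) (R : realType).
Variable mu : {measure set T -> \bar R}.

(* Membership in L^1 follows from the last two conditions. *)
Definition is_pdf (f : T -> R) :=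
  [/\ measurable_fun setT f, {ae mu, forall x, 0 <= f x} &
      (\int[mu]_x (f x)%:E = 1)%E].

(* Classes modulo mu-almost everywhere equality; Leibniz equality on this type
   is equality almost everywhere of representatives (pdf_eqP). Each class of
   Lebesgue-measurable functions has a Borel representative, so nothing is lost
   by quotienting Borel functions. *)
Definition pdf :=
  {f : {mfun_ mu, T >-> measurableTypeR R} | `[< is_pdf f >]}.

Definition pdf_fun (f : pdf) : T -> R := val f.

End pdf.
Coercion pdf_fun : pdf >-> Funclass.

Definition densityR (R : realType) := pdf (@lebesgue_measure R).
Definition kernel01 (R : realType) := pdf (@lebesgue01 R).
Identity Coercion pdf_of_densityR : densityR >-> pdf.
Identity Coercion pdf_of_kernel01 : kernel01 >-> pdf.

Definition cdf_fun (R : realType) (f : R -> R) (x : R) : R :=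
  \int[@lebesgue_measure R]_(t in `]-oo, x]) f t.

(* If g is a density with distribution function F, the image under F of the
   measure g dx is the Lebesgue measure on [0, 1]. *)
Section cdf.
Variables (R : realType) (g : R -> R).
Local Notation mu := (@lebesgue_measure R).
Hypothesis mg : measurable_fun setT g.
Hypothesis g0 : forall x, 0 <= g x.
Hypothesis g1 : (\int[mu]_x (g x)%:E = 1)%E.

Definition pdf_prob (A : set (measurableTypeR R)) : \bar R :=
  (\int[mu]_(x in A) (g x)%:E)%E.

Let mEg (D : set R) : measurable_fun D (fun x => (g x)%:E).
Proof. by apply/measurable_EFinP; exact: measurable_funTS. Qed.

Let P0 : pdf_prob set0 = 0%E.
Proof. exact: integral_set0. Qed.

Let Pge0 A : (0 <= pdf_prob A)%E.
Proof. by apply: integral_ge0 => x _; rewrite lee_fin. Qed.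

Let Psigma : semi_sigma_additive pdf_prob.
Proof.
move=> /= A mA tA mUA.
rewrite /pdf_prob ge0_integral_bigcup//=; last by move=> x _; rewrite lee_fin.
  by apply: is_cvg_ereal_nneg_natsum_cond => n _ _; exact: Pge0.
exact: mEg.
Qed.

HB.instance Definition _ := isMeasure.Build _ _ _ pdf_prob P0 Pge0 Psigma.
HB.instance Definition _ :=
  @Measure_isProbability.Build _ _ R pdf_prob g1.

Let P : probability _ R := pdf_prob.

Let igT : mu.-integrable setT (EFin \o g).
Proof.
apply/integrableP; split; first exact: mEg.
under eq_integral do rewrite gee0_abs ?lee_fin//.
by rewrite g1 ltry.
Qed.

Let FE x : (cdf_fun g x)%:E = P `]-oo, x]%classic.
Proof. by rewrite -[RHS]fineK//; exact: fin_num_measure. Qed.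

Let Fge0 x : 0 <= cdf_fun g x.
Proof. by rewrite -lee_fin FE. Qed.

Let Fle1 x : cdf_fun g x <= 1.
Proof. by rewrite -lee_fin FE probability_le1. Qed.

Let Fnd : {homo cdf_fun g : x y / x <= y}.
Proof.
move=> x y xy; rewrite -lee_fin !FE le_measure ?inE//.
exact: subset_itvl.
Qed.

Let mF : measurable_fun setT (cdf_fun g).
Proof. by apply: nondecreasing_measurable. Qed.

Let idTR : measurableTypeR R -> R := idfun.
#[local] HB.instance Definition _ :=
  @isMeasurableFun.Build _ _ _ _ idTR (@measurable_id _ _ setT).

Let cdfE x : cdf (idTR : {RV P >-> R}) x = (cdf_fun g x)%:E.
Proof. by rewrite FE /cdf /distribution /pushforward preimage_id. Qed.

Let F_lt (z : R) : 0 < z -> exists x, cdf_fun g x < z.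
Proof.
move=> z0; have := cvg_cdfNy0 (idTR : {RV P >-> R}).
rewrite (_ : cdf _ = EFin \o cdf_fun g); last by apply/funext => x; exact: cdfE.
move/fine_cvgP => [_] /cvgr_lt /(_ _ z0).
move=> [M [Mr]] /(_ (M - 1)); rewrite /= ltrBlDr ltrDl ltr01 => /(_ isT) h.
by exists (M - 1).
Qed.

Let F_gt (z : R) : z < 1 -> exists x, z < cdf_fun g x.
Proof.
move=> z0; have := cvg_cdfy1 (idTR : {RV P >-> R}).
rewrite (_ : cdf _ = EFin \o cdf_fun g); last by apply/funext => x; exact: cdfE.
move/fine_cvgP => [_] /cvgr_gt /(_ _ z0).
move=> [M [Mr]] /(_ (M + 1)); rewrite /= ltrDl ltr01 => /(_ isT) h.
by exists (M + 1).
Qed.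

Let FB x y : x <= y ->
  cdf_fun g y - cdf_fun g x = \int[mu]_(t in `]x, y]) `|g t|.
Proof.
move=> xy; under [RHS]eq_Rintegral do rewrite ger0_norm//.
have -> : \int[mu]_(t in `]x, y]) g t = fine (P `]x, y]%classic) by [].
apply/EFin_inj; rewrite EFinB !FE fineK; last exact: fin_num_measure.
have -> : `]-oo, y]%classic = `]-oo, x] `|` `]x, y].
  by rewrite -itv_bndbnd_setU ?bnd_simp.
rewrite measureU//.
  by rewrite addeAC subee ?add0e//; exact: fin_num_measure.
by apply/seteqP; split => // t /=; rewrite !in_itv/= => -[tx /andP[/(le_lt_trans tx)]]; rewrite ltxx.
Qed.

Let cF : continuous (cdf_fun g).
Proof.
move=> x; apply/cvgrPdist_lt => e e0.
have [d [d0 hd]] := integral_normr_continuous igT e0.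
near=> y.
have xyd : `|x - y| < d by near: y; exact: cvgr_dist_lt.
have h u v : u <= v -> `|u - v| < d -> cdf_fun g v - cdf_fun g u < e.
  move=> uv uvd; rewrite FB//; apply: hd; first exact: measurable_itv.
  rewrite [X in (X < _)%E](lebesgue_measure_itv `]u, v])/= lte_fin; case: ifPn => // _.
  by rewrite -EFinB lte_fin (le_lt_trans _ uvd)// distrC ler_norm.
have [xy|/ltW yx] := leP x y.
  by rewrite distrC ger0_norm ?subr_ge0 ?Fnd// h.
by rewrite ger0_norm ?subr_ge0 ?Fnd// h// distrC.
Unshelve. all: by end_near. Qed.

Let F_eq (z : R) : 0 < z -> z < 1 -> exists x, cdf_fun g x = z.
Proof.
move=> z0 z1; have [a az] := F_lt z0; have [b zb] := F_gt z1.
have ab : a <= b.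
  by rewrite leNgt; apply/negP => /ltW/Fnd; rewrite leNgt (lt_trans az).
have [||c _ <-] := @IVT _ (cdf_fun g) a b z ab; last by exists c.
- exact: continuous_subspaceT.
- by rewrite (min_idPl _) ?(max_idPr _) ?Fnd// (ltW az) (ltW zb).
Qed.

Let PFgt (z : R) : P [set x | z < cdf_fun g x] = lebesgue01 R `]z, +oo[%classic.
Proof.
have mgt y : measurable [set x : R | y < cdf_fun g x].
  rewrite [X in measurable X](_ : _ = setT `&` (cdf_fun g) @^-1` `]y, +oo[).
    exact: mF.
  by apply/seteqP; split => t /=; rewrite in_itv/= andbT => // -[].
have Pray s : P `]s, +oo[%classic = (1 - cdf_fun g s)%:E.
  by rewrite EFinB FE -setCitvl probability_setC//.
have [z0|z0] := ltP z 0.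
  rewrite [X in P X](_ : _ = setT); last first.
    by apply/seteqP; split => // t _ /=; exact: lt_le_trans (Fge0 _).
  rewrite probability_setT /= /lebesgue01 /= /mrestr setIidr; last first.
    by move=> t /=; rewrite !in_itv/= andbT => /andP[t0 _]; exact: lt_le_trans t0.
  by rewrite lebesgue_measure_itv/= lte_fin ltr01 sube0.
have [z1|z1] := leP 1 z.
  rewrite [X in P X](_ : _ = set0); last first.
    by apply/seteqP; split => // t /=; rewrite ltNge (le_trans (Fle1 t)).
  rewrite measure0 /= /lebesgue01 /= /mrestr.
  suff -> : `]z, +oo[%classic `&` `[0, 1]%classic = set0 by rewrite measure0.
  apply/seteqP; split => // t /=; rewrite !in_itv/= andbT => -[zt /andP[_ t1]].
  by have := lt_le_trans zt (le_trans t1 z1); rewrite ltxx.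
transitivity (1 - z)%:E; last first.
  rewrite /= /lebesgue01 /= /mrestr.
  suff -> : `]z, +oo[%classic `&` `[0, 1]%classic = `]z, 1]%classic.
    by rewrite lebesgue_measure_itv/= lte_fin z1.
  apply/seteqP; split => t /=; rewrite !in_itv/= andbT.
    by move=> [-> /andP[]].
  by move=> /andP[zt t1]; rewrite zt t1 (ltW (le_lt_trans z0 zt)).
apply/eqP; rewrite eq_le; apply/andP; split.
  have [->|zn0] := eqVneq z 0; first by rewrite subr0; apply: (@probability_le1 _ _ _ P); exact: mgt.
  have zp : 0 < z by rewrite lt_neqAle eq_sym zn0 z0.
  have [s Fs] := F_eq zp z1.
  rewrite -[in leRHS]Fs -Pray; apply: (@le_measure _ _ _ P); rewrite ?inE//.
    exact: mgt.
  move=> t /= zt; rewrite in_itv/= andbT.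
  by rewrite ltNge; apply/negP => /Fnd; rewrite Fs leNgt zt.
apply/lee_addgt0Pr => e e0.
have [ze|ze] := ltP (z + e) 1; last first.
  by rewrite (@le_trans _ _ e%:E)// ?lee_fin ?lerBlDl// leeDr.
have [||s Fs] := @F_eq (z + e) _ _ => //; first by rewrite ltr_wpDl.
rewrite -leeBlDr// -EFinB -addrA -opprD -Fs -Pray.
apply: (@le_measure _ _ _ P); rewrite ?inE//.
  exact: mgt.
move=> t /=; rewrite in_itv/= andbT => /ltW/Fnd; apply: lt_le_trans.
by rewrite Fs ltrDl.
Qed.

Let F : measurableTypeR R -> measurableTypeR R := cdf_fun g.

Lemma pushforward_cdf (A : set (measurableTypeR R)) : measurable A ->
  P (cdf_fun g @^-1` A) = lebesgue01 R A.
Proof.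
have mF' : measurable_fun setT F by exact: mF.
pose Q0 : {measure set (measurableTypeR R) -> \bar R} := pushforward P F.
pose Q := Q0 mF'.
move=> mA; rewrite -[LHS]/(Q A).
apply: (@measure_unique _ R (measurableTypeR R) (@RGenOInfty.G R)
  (fun n => `](- n%:R), +oo[%classic) _ _ _ _ Q (lebesgue01 R)) => //=.
- exact: RGenOInfty.measurableE.
- move=> _ _ [a ->] [b ->]; exists (Num.max a b).
  apply/seteqP; split => x /=; rewrite !in_itv/= !andbT.
    by move=> [? ?]; rewrite gt_max; apply/andP.
  by rewrite gt_max => /andP.
- by move=> n; exists (- n%:R).
- apply/seteqP; split => // x _; exists (Num.truncn `|x|).+1 => //=.
  rewrite in_itv/= andbT ltrNl (le_lt_trans _ (truncnS_gt _))//.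
  by rewrite -normrN ler_norm.
- move=> _ [z ->]; rewrite /Q /= /pushforward -PFgt; congr (P _).
  by apply/seteqP; split => t /=; rewrite in_itv/= andbT.
- move=> k; rewrite /Q /= /pushforward (@le_lt_trans _ _ 1%E) ?ltry//.
  apply: probability_le1.
  by rewrite -[X in measurable X]setTI; exact: mF.
Qed.

Let Pdom : P `<< mu.
Proof.
apply/null_content_dominatesP => A mA A0.
by apply: null_set_integral => //; exact: mEg.
Qed.

Lemma integral_cdf (h : R -> R) : measurable_fun setT h -> (forall z, 0 <= h z) ->
  (\int[mu]_x (h (cdf_fun g x) * g x)%:E = \int[lebesgue01 R]_z (h z)%:E)%E.
Proof.
move=> mh h0.
have mhE : measurable_fun setT (EFin \o h : measurableTypeR R -> \bar R).
  exact/measurable_EFinP.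
have mhF : measurable_fun setT (EFin \o (h \o F) : measurableTypeR R -> \bar R).
  by apply/measurable_EFinP; apply: measurableT_comp.
pose r := Radon_Nikodym_SigmaFinite.f P mu.
have rint : mu.-integrable setT r by apply: Radon_Nikodym_SigmaFinite.f_integrable.
have rg : ae_eq mu setT (r : measurableTypeR R -> \bar R) (EFin \o g).
  apply: integral_ae_eq => //.
    exact: mEg.
  by move=> A _ mA; rewrite -Radon_Nikodym_SigmaFinite.f_integral.
transitivity (\int[P]_x (h (F x))%:E)%E.
  rewrite -[RHS](Radon_Nikodym_SigmaFinite.change_of_variables Pdom)//; last first.
    by move=> x; rewrite lee_fin.
  apply: ae_eq_integral => //.
  - apply/measurable_EFinP; apply: measurable_funM => //.
    exact: measurableT_comp.
  - apply: emeasurable_funM => //; exact: (measurable_int _ rint).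
  - by apply: filterS rg => x /(_ I)/= rx _; rewrite -/r rx EFinM.
have mF' : measurable_fun setT F by exact: mF.
rewrite -[LHS](@ge0_integral_pushforward _ _ _ _ _ F mF' P setT (EFin \o h))//; last first.
  by move=> z _; rewrite lee_fin.
apply: eq_measure_integral => A mA _.
by rewrite -pushforward_cdf.
Qed.

Lemma ae_cdf (Q : set R) : {ae lebesgue01 R, forall z, Q z} ->
  {ae mu, forall x, g x != 0 -> Q (cdf_fun g x)}.
Proof.
move=> [N [mN N0 QN]].
have mFN : measurable (F @^-1` N) by rewrite -[X in measurable X]setTI; exact: mF.
have PN : (\int[mu]_(x in F @^-1` N) `|(g x)%:E| = 0)%E.
  under eq_integral do rewrite gee0_abs ?lee_fin//.
  rewrite -[LHS]/(P _) -N0; exact: pushforward_cdf.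
have /ae_eq_integral_abs : measurable_fun (F @^-1` N) (EFin \o g) by exact: mEg.
move=> /(_ mu mFN) [+ _] => /(_ PN).
apply: filterS => x /= gx gn0; apply: contrapT => /QN /gx [] /eqP.
by rewrite (negbTE gn0).
Qed.

Lemma cdf_fun_ge0_le1 x : 0 <= cdf_fun g x <= 1.
Proof. by rewrite Fge0 Fle1. Qed.

Lemma measurable_cdf_fun : measurable_fun setT (cdf_fun g).
Proof. exact: mF. Qed.

End cdf.

Section pdf_theory.
Local Open Scope quotient_scope.
Context d (T : measurableType d) (R : realType).
Variable mu : {measure set T -> \bar R}.
Implicit Types (f g : T -> R) (D : set T).

Lemma is_pdf_ae f g : measurable_fun setT g -> f = g %[ae mu] ->
  is_pdf mu f -> is_pdf mu g.
Proof.
move=> mg fg [mf f0 f1]; split => //.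
  by apply: filterS2 fg f0 => x fgx fx0; rewrite -fgx.
rewrite -f1; apply: ae_eq_integral => //; try exact/measurable_EFinP.
by apply: filterS fg => x + _ => ->.
Qed.

Lemma is_pdf_nneg f : is_pdf mu f ->
  exists g, [/\ is_pdf mu g, forall x, 0 <= g x & f = g %[ae mu]].
Proof.
move=> fp; have [mf f0 f1] := fp; exists (fun x => Num.max (f x) 0).
have fg : f = (fun x => Num.max (f x) 0) %[ae mu].
  by apply: filterS f0 => x fx0 _; rewrite (max_idPl _).
split => //; last by move=> x; rewrite le_max lexx orbT.
by apply: is_pdf_ae fg fp; exact: measurable_maxr.
Qed.

Lemma ae_eq_Rintegral f g D : measurable D -> measurable_fun setT f ->
  measurable_fun setT g -> f = g %[ae mu] ->
  \int[mu]_(x in D) f x = \int[mu]_(x in D) g x.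
Proof.
move=> mD mf mg fg; congr fine; apply: ae_eq_integral => //.
- by apply/measurable_EFinP; exact: measurable_funTS.
- by apply/measurable_EFinP; exact: measurable_funTS.
- by apply: filterS fg => x /(_ I) /= ->.
Qed.

Lemma Rintegral_pdf01 f D : is_pdf mu f -> measurable D ->
  0 <= \int[mu]_(x in D) f x <= 1.
Proof.
move=> fp mD; have [mf _ _] := fp; have [g [[mg _ g1] g0 fg]] := is_pdf_nneg fp.
rewrite (ae_eq_Rintegral mD mf mg fg) Rintegral_ge0//=.
have gle : (\int[mu]_(x in D) (g x)%:E <= 1)%E.
  rewrite -g1; apply: ge0_subset_integral => //; first exact/measurable_EFinP.
  by move=> x _; rewrite lee_fin.
rewrite -lee_fin /Rintegral fineK// ge0_fin_numE.
  exact: le_lt_trans gle (ltry _).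
by apply: integral_ge0 => x _; rewrite lee_fin.
Qed.

Lemma pdfP (f : pdf mu) : is_pdf mu f.
Proof. exact: asboolW (valP f). Qed.

Lemma pdf_eqP (f g : pdf mu) : f = g <-> f = g %[ae mu].
Proof.
split=> [->|fg]; first exact: aeW.
apply/val_inj; rewrite -[val f]reprK -[val g]reprK.
by apply/eqmodP/asboolP.
Qed.

Section mk_pdf.
Variables (f : T -> R) (fp : is_pdf mu f).

Let mf : measurable_fun setT (f : T -> measurableTypeR R).
Proof. by case: fp. Qed.

Let f_ : {mfun T >-> measurableTypeR R} :=
  HB.pack (f : T -> measurableTypeR R) (isMeasurableFun.Build _ _ _ _ _ mf).
Let q : {mfun_ mu, T >-> measurableTypeR R} := \pi f_.

Lemma mk_pdf_subproof : (q : T -> R) = f %[ae mu].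
Proof.
have /eqmodP/asboolP : repr q = f_ %[mod {mfun_ mu, T >-> measurableTypeR R}].
  by rewrite reprK.
exact.
Qed.

Let q_pdf : `[< is_pdf mu (q : T -> R) >].
Proof.
apply/asboolP; apply: (is_pdf_ae (f := f)) => //.
  exact: (measurable_funPT (repr q)).
by apply: filterS mk_pdf_subproof => x h _; rewrite h.
Qed.

Definition mk_pdf : pdf mu := exist _ q q_pdf.

Lemma mk_pdfE : mk_pdf = f %[ae mu].
Proof. exact: mk_pdf_subproof. Qed.

End mk_pdf.
End pdf_theory.

Section derangetropy.
Variable R : realType.
Local Notation I := {i01 R}.
Local Notation mu := (@lebesgue_measure R).

Lemma Rintegral01_subproof d (T : measurableType d)
    (m : {measure set T -> \bar R}) (f : pdf m) (D : set T) :
  measurable D -> (0 <= \int[m]_(t in D) f t) /\ (\int[m]_(t in D) f t <= 1).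
Proof. by move=> mD; apply/andP; exact: Rintegral_pdf01 (pdfP f) mD. Qed.

Definition density_cdf (f : densityR R) (x : R) : I :=
  let h := Rintegral01_subproof f (measurable_itv `]-oo, x]) in
  Itv01 h.1 h.2.

(* A_w(z) = \int_0^z w(s) ds *)
Definition kernel_cdf (w : kernel01 R) (z : I) : I :=
  let h := Rintegral01_subproof w (measurable_itv `[0, z%:num]) in
  Itv01 h.1 h.2.

Lemma ae_density (f : densityR R) (Q : set R) :
  {ae lebesgue01 R, forall z, Q z} ->
  {ae mu, forall x, f x != 0 -> Q (density_cdf f x)%:num}.
Proof.
have [g [[mg _ g1] g0 fg]] := is_pdf_nneg (pdfP f).
have [mf _ _] := pdfP f.
have Fg x : (density_cdf f x)%:num = cdf_fun g x by exact: ae_eq_Rintegral fg.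
move=> /(ae_cdf mg g0 g1); apply: filterS2 fg => x /(_ Logic.I) fgx.
by rewrite fgx Fg.
Qed.

Lemma is_pdf_derangetropy (w : kernel01 R) (f : densityR R) :
  is_pdf mu (fun x => w (density_cdf f x)%:num * f x).
Proof.
have [g [[mg _ g1] g0 fg]] := is_pdf_nneg (pdfP f).
have [mf _ _] := pdfP f.
have [w' [[mw' _ w'1] w'0 ww']] := is_pdf_nneg (pdfP w).
have [mw _ _] := pdfP w.
have Fg x : (density_cdf f x)%:num = cdf_fun g x by exact: ae_eq_Rintegral fg.
have mF : measurable_fun setT (cdf_fun g) by exact: measurable_cdf_fun.
apply: (@is_pdf_ae _ (measurableTypeR R) R mu (fun x => w' (cdf_fun g x) * g x)).
- apply: measurable_funM => //.
  have -> : (fun x => w (density_cdf f x)%:num) = w \o cdf_fun g.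
    by apply/funext => x; exact: congr1 (Fg x).
  exact: measurableT_comp.
- apply: filterS2 fg (ae_density f ww') => x /(_ Logic.I) fgx wx _.
  rewrite -Fg -fgx; have [->|fx] := eqVneq (f x) 0; first by rewrite !mulr0.
  by rewrite wx.
- split.
  + by apply: measurable_funM => //; exact: measurableT_comp.
  + by apply: aeW => x; rewrite mulr_ge0.
  + by rewrite integral_cdf.
Qed.

(* rho_w[f](x) = w(F(x)) f(x); the value on classes does not depend on the
   representatives (derangetropyE). *)
Definition derangetropy (w : kernel01 R) (f : densityR R) : densityR R :=
  mk_pdf (is_pdf_derangetropy w f).

Lemma derangetropyE (w : kernel01 R) (f : densityR R) (w0 f0 : R -> R) :
  w = w0 %[ae lebesgue01 R] -> f = f0 %[ae mu] ->
  derangetropy w f = (fun x => w0 (density_cdf f x)%:num * f0 x) %[ae mu].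
Proof.
move=> ww0 ff0; have := mk_pdfE (is_pdf_derangetropy w f).
apply: filterS3 ff0 (ae_density f ww0) => x /(_ Logic.I) fx wx /(_ Logic.I) + _.
rewrite -/(derangetropy w f) => ->; rewrite -fx.
by have [->|fn0] := eqVneq (f x) 0; rewrite ?mulr0// wx.
Qed.

Definition clamp01 (x : R) : R := Num.min (Num.max 0 x) 1.
Lemma clamp01_ge0 x : 0 <= clamp01 x.
Proof. by rewrite le_min le_max lexx ler01. Qed.
Lemma clamp01_le1 x : clamp01 x <= 1.
Proof. by rewrite ge_min lexx orbT. Qed.

(* Constant extension to the line of a self-map of [0, 1]. It only serves to
   take derivatives at points of ]0, 1[, where the extension is irrelevant. *)
Definition ext01 (a : I -> I) (x : R) : R :=
  (a (Itv01 (clamp01_ge0 x) (clamp01_le1 x)))%:num.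

(* u is the class of the almost everywhere derivative of a; this determines u. *)
Definition is_derivative01 (a : I -> I) (u : kernel01 R) :=
  {ae lebesgue01 R, forall z : R, is_derive z 1 (ext01 a) (u z)}.

Definition abs_continuous01 (a : I -> I) :=
  forall e : R, 0 < e -> exists2 d : R, 0 < d &
    forall (n : nat) (x y : 'I_n -> I),
      (forall i, x i <= y i) ->
      (forall i j, i != j -> (y i <= x j) || (y j <= x i)) ->
      \sum_(i < n) ((y i)%:num - (x i)%:num) < d ->
      \sum_(i < n) `|(a (y i))%:num - (a (x i))%:num| < e.

Definition ac_surjections : set (I -> I) :=
  [set a | [/\ abs_continuous01 a, {homo a : x y / x <= y} &
               forall y, exists x, a x = y]].

End derangetropy.

(* Submonoids of the monoid of self-maps of T, and isomorphisms between two such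
   submonoids; only the values of Phi on M matter. *)
Definition submonoid (T : Type) (M : set (T -> T)) :=
  M id /\ forall a b, M a -> M b -> M (a \o b).

Definition monoid_iso (S T : Type) (M : set (S -> S)) (N : set (T -> T))
    (Phi : (S -> S) -> (T -> T)) :=
  [/\ submonoid M, submonoid N, set_bij M N Phi, Phi id = id &
      forall a b, M a -> M b -> Phi (a \o b) = Phi a \o Phi b].

(* Main.v *)
Require Import Defs.
From HB Require Import structures.
From mathcomp Require Import all_boot all_order all_algebra.
From mathcomp Require Import all_classical all_reals all_analysis measurable_realfun.

From mathcomp Require Import lra.
Set Implicit Arguments.
Unset Strict Implicit.
Unset Printing Implicit Defensive.

Import Order.TTheory GRing.Theory Num.Theory.
Import numFieldNormedType.Exports.

Local Open Scope classical_set_scope.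
Local Open Scope ring_scope.

(** The whole theorem rests on one identity and two facts about distribution
    functions.

    The identity is that [rho_w] acts on distribution functions by composition
    with [A_w] on the left: if [f] has distribution function [F], then
    [rho_w[f]] has distribution function [A_w \o F]
    ([density_cdf_derangetropy]). This is the change of variables [z = F t]:
    [F] sends the measure [f t dt] to the Lebesgue measure of [0, 1], and up to
    a set that this measure does not see, [t <= x] is equivalent to
    [F t <= F x].

    The first fact is that a density is determined by its distribution function,
    being its derivative almost everywhere ([density_cdf_inj]). An equality
    between operators [rho] thus reduces to an equality between maps [A], and
    composition of operators to composition of maps. The same fact, applied to a
    kernel extended by zero to the line, says that [w] is the derivative of
    [A_w], so that [A_w] determines [w].

    The second fact is that the maps [A_w] are exactly the absolutely continuous
    nondecreasing surjections of [0, 1]. Such surjections are plainly closed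
    under composition, hence [A_v \o A_w = A_u] for some [u], which is then the
    derivative of [A_v \o A_w], and [rho_v \o rho_w = rho_u]. That every such
    surjection [a] is some [A_w] ([kernel_cdf_onto]) is shown with the
    Stieltjes measure of [a]: it is dominated by the Lebesgue measure
    ([abs_continuous01_null_dominates]), and its Radon-Nikodym density
    restricted to [0, 1] is the kernel.

    The isomorphism needs no choice of kernels: evaluating an operator at the
    uniform density, whose distribution function is the identity of [0, 1],
    yields [A_w] as the distribution function of [rho_w] of that density. The
    formulas for iterates follow by induction from the identity. *)

(** * Integration against the Lebesgue measure of [0, 1] *)

Section lebesgue01.
Variable R : realType.
Local Notation mu := (@lebesgue_measure R).
Local Notation mu01 := (@lebesgue01 R).
Implicit Types (P : set R).

Lemma ae_lebesgue01 P :
  {ae mu01, forall x, P x} <-> {ae mu, forall x, x \in `[0, 1] -> P x}.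
Proof.
split=> [[N [mN N0 PN]]|[N [mN N0 PN]]].
  exists (N `&` `[0, 1]%classic); split => //; first exact: measurableI.
  by move=> x /= /not_implyP[x01 Px]; split => //; exact: PN.
exists (N `|` ~` `[0, 1]%classic); split.
- by apply: measurableU => //; exact: measurableC.
- rewrite /= /lebesgue01 /= /mrestr setIUl setICl setU0.
  apply/eqP; rewrite eq_le measure_ge0 andbT -N0 le_measure ?inE//.
  exact: measurableI.
- move=> x /= Px; have [x01|x01] := pselect (x \in `[0, 1]); last by right.
  by left; apply: PN => /= /(_ x01).
Qed.

Lemma integral_lebesgue01 (D : set R) (f : R -> \bar R) :
  measurable D -> measurable_fun setT f ->
  (\int[mu01]_(x in D) f x = \int[mu]_(x in D `&` `[0%R, 1%R]) f x)%E.
Proof.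
move=> mD mf; have mD' : measurable (D `&` `[0, 1]%classic) by exact: measurableI.
transitivity (\int[mu01]_(x in D `&` `[0%R, 1%R]) f x)%E.
  rewrite [LHS]integral_mkcond [RHS]integral_mkcond.
  apply: ae_eq_integral => //.
  - by apply/(measurable_restrictT _ _).1 => //; exact: measurable_funTS.
  - by apply/(measurable_restrictT _ _).1 => //; exact: measurable_funTS.
  - apply/ae_lebesgue01/aeW => x x01 _; rewrite !patchE.
    by rewrite in_setI [X in _ && X]mem_set// andbT.
apply: eq_measure_integral => A mA AD; rewrite /= /lebesgue01 /= /mrestr setIidl//.
by apply: subset_trans AD _; exact: subIsetr.
Qed.

End lebesgue01.

(** * Densities and their distribution functions *)

Section densities.
Variable R : realType.
Local Notation mu := (@lebesgue_measure R).

Lemma is_pdf_integrable (f : R -> R) : is_pdf mu f ->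
  mu.-integrable setT (EFin \o f).
Proof.
move=> fp; have [mf _ _] := fp; have [g [[mg _ g1] g0 fg]] := is_pdf_nneg fp.
apply/integrableP; split; first exact/measurable_EFinP.
rewrite (ae_eq_integral (EFin \o g))//; last 3 first.
- by apply: measurableT_comp => //; exact/measurable_EFinP.
- exact/measurable_EFinP.
- by apply: filterS fg => x /(_ I) /= -> _; rewrite ger0_norm.
by rewrite g1 ltry.
Qed.

Lemma cdf_fun_homo (f : R -> R) : mu.-integrable setT (EFin \o f) ->
  (forall x, 0 <= f x) -> {homo cdf_fun f : x y / x <= y}.
Proof.
move=> fi f0 x y xy; have mf := measurable_int _ fi.
apply: fine_le.
- by apply: integrable_fin_num => //; exact: integrableS fi.
- by apply: integrable_fin_num => //; exact: integrableS fi.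
- apply: ge0_subset_integral => //.
  + exact: measurable_funTS.
  + by move=> t _; rewrite lee_fin.
  + exact: subset_itvl.
Qed.

(** The Lebesgue differentiation theorem. *)
Lemma is_derive_density_cdf (f : densityR R) :
  {ae mu, forall x : R, is_derive x 1 (fun y : R => (density_cdf f y)%:num) (f x)}.
Proof.
have fi := is_pdf_integrable (pdfP f).
have fiy y : mu.-integrable `]-oo, y] (EFin \o f) by exact: integrableS fi.
have floc : locally_integrable [set: R] f.
  suff -> : (f : R -> R) = f \_ setT by exact: integrable_locally.
  by apply/funext => y; rewrite patchE in_setT.
have := FTC1Ny fiy floc.
apply: filterS; first exact: (ae_filter_ringOfSetsType mu).
move=> x [dF F'].
apply: DeriveDef; [exact: dF|rewrite -derive1E; exact: F'].
Qed.

Lemma density_cdf_inj : injective (@density_cdf R).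
Proof.
move=> f g fg; apply/pdf_eqP.
have := is_derive_density_cdf g; have := is_derive_density_cdf f; rewrite fg.
apply: filterS2; first exact: (ae_filter_ringOfSetsType mu).
move=> x Df Dg _.
by rewrite -(@derive_val _ _ _ _ _ _ _ Df) (@derive_val _ _ _ _ _ _ _ Dg).
Qed.

(** The substitution [z = F t] turns the integral of [w (F t) f t] over
    [F t <= F x] into that of [w] over [0, F x]. The domain [F t <= F x] may be
    larger than [t <= x], but only by points where [F] takes the value [F x],
    and [f] vanishes at almost every such point. *)
Lemma density_cdf_derangetropy (w : kernel01 R) (f : densityR R) (x : R) :
  density_cdf (derangetropy w f) x = kernel_cdf w (density_cdf f x).
Proof.
apply/val_inj => /=.
have [g [gp g0 fg]] := is_pdf_nneg (pdfP f); have [mg _ g1] := gp.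
have [w' [[mw' _ w'1] w'0 ww']] := is_pdf_nneg (pdfP w).
have [mw _ _] := pdfP w.
have [mf _ _] := pdfP f.
have [mwf _ _] := pdfP (derangetropy w f).
have Fg y : (density_cdf f y)%:num = cdf_fun g y by exact: ae_eq_Rintegral fg.
have mF : measurable_fun setT (cdf_fun g) by exact: measurable_cdf_fun.
have Fnd : {homo cdf_fun g : s t / s <= t}.
  by apply: cdf_fun_homo => //; exact: is_pdf_integrable.
set z := cdf_fun g x.
have Fgx : \int[mu]_(t in `]-oo, x]) f t = z by exact: Fg.
rewrite Fgx; congr fine.
pose h := w' \_ `[0, z]%classic.
have mh : measurable_fun setT h.
  by apply/(measurable_restrictT _ _).1 => //; exact: measurable_funTS.
transitivity (\int[mu]_t (h (cdf_fun g t) * g t)%:E)%E; last first.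
  rewrite (integral_cdf mg g0 g1 mh); last first.
    by move=> t; rewrite /h patchE; case: ifP.
  rewrite [RHS]integral_mkcond; apply: ae_eq_integral => //.
  - exact/measurable_EFinP.
  - apply/(measurable_restrictT _ _).1 => //; apply: measurable_funTS.
    exact/measurable_EFinP.
  - apply: filterS ww' => t /(_ I) wt _; rewrite /h !patchE/=.
    by case: ifP => //=; rewrite wt.
rewrite [LHS]integral_mkcond; apply: ae_eq_integral => //.
- apply/(measurable_restrictT _ _).1 => //; apply: measurable_funTS.
  exact/measurable_EFinP.
- apply/measurable_EFinP; apply: measurable_funM => //.
  exact: measurableT_comp.
(* A single value of F is negligible for the image of g dx under F. *)
have Fz : {ae mu, forall t, g t != 0 -> cdf_fun g t != z}.
  apply: (ae_cdf mg g0 g1 (Q := [set y | y != z])).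
  apply/ae_lebesgue01; exists [set z]; split => //.
    exact: lebesgue_measure_set1.
  by move=> y /= /not_implyP[_ /negP/negPn/eqP].
apply: filterS2 Fz (derangetropyE ww' fg) => t gtz /(_ I) rt _.
rewrite !patchE /= rt Fg.
have [gt0|/gtz Ftz] := eqVneq (g t) 0.
  by rewrite gt0 !mulr0; case: ifP.
have zle : (t \in `]-oo, x]%classic) = (cdf_fun g t \in `[0, z]%classic).
  rewrite !mem_setE !in_itv/= (andP (cdf_fun_ge0_le1 mg g0 g1 t)).1/=.
  apply/idP/idP => [/Fnd//|Ftle]; rewrite leNgt; apply/negP => /ltW/Fnd.
  by rewrite leNgt lt_neqAle Ftz Ftle.
by rewrite /h patchE zle; case: ifP => //; rewrite mul0r.
Qed.
End densities.

(** * Kernels as densities on the line *)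

Section kernels.
Variable R : realType.
Local Notation I := {i01 R}.
Local Notation mu := (@lebesgue_measure R).
Local Notation mu01 := (@lebesgue01 R).
Implicit Types (w : kernel01 R) (x : R) (z : I).

Definition proj01 (x : R) : I := Itv01 (clamp01_ge0 x) (clamp01_le1 x).

Lemma proj01K z : proj01 z%:num = z.
Proof.
apply/val_inj => /=; rewrite /clamp01 max_r//; exact: min_l.
Qed.

Lemma proj01_homo : {homo proj01 : x y / x <= y}.
Proof.
move=> x y xy; change (clamp01 x <= clamp01 y).
by rewrite /clamp01 le_min !ge_min ge_max !le_max !lexx xy !orbT.
Qed.

Lemma proj01_le0 x : x <= 0 -> (proj01 x)%:num = 0.
Proof. by move=> x0; rewrite /= /clamp01 max_l// min_l. Qed.

Lemma proj01_ge1 x : 1 <= x -> (proj01 x)%:num = 1.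
Proof. by move=> x1; rewrite /= /clamp01 min_r// le_max x1 orbT. Qed.

Lemma is_pdf_kernel_density w : is_pdf mu (w \_ `[0, 1]).
Proof.
have [mw w0 w1] := pdfP w; split.
- by apply/(measurable_restrictT _ _).1 => //; exact: measurable_funTS.
- have := (ae_lebesgue01 _).1 w0.
  apply: filterS; first exact: (ae_filter_ringOfSetsType mu).
  move=> x wx; rewrite patchE.
  by case: ifPn => //; rewrite mem_setE.
- rewrite -w1 integral_lebesgue01 ?setTI//; last exact/measurable_EFinP.
  rewrite [RHS]integral_mkcond; apply: eq_integral => x _.
  by rewrite !patchE; case: ifP.
Qed.

(** Extending a kernel by zero makes the results on densities of the line
    available for kernels. *)
Definition kernel_density w : densityR R := mk_pdf (is_pdf_kernel_density w).

Lemma ext01_kernel_cdf w x :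
  ext01 (kernel_cdf w) x = (density_cdf (kernel_density w) x)%:num.
Proof.
have [mw _ _] := pdfP w; have mwE := (measurable_EFinP _ _).2 mw.
have [mk _ _] := pdfP (kernel_density w).
rewrite /ext01 /=; congr fine.
rewrite integral_lebesgue01// [LHS]integral_mkcond [RHS]integral_mkcond.
apply: ae_eq_integral => //.
- apply/(measurable_restrictT _ _).1; first exact: measurableI.
  exact: measurable_funTS.
- apply/(measurable_restrictT _ _).1 => //; apply: measurable_funTS.
  exact/measurable_EFinP.
(* For x < 0 the left-hand domain is {0}, the right-hand one is empty. *)
have n0 : {ae mu, forall t : R, t != 0}.
  exists [set 0]; split => //; first exact: lebesgue_measure_set1.
  by move=> t /= /negP/negPn/eqP.
move: n0 (mk_pdfE (is_pdf_kernel_density w)).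
apply: filterS2; first exact: (ae_filter_ringOfSetsType mu).
move=> t t0 /(_ Logic.I) kt _.
rewrite !patchE [in RHS]kt patchE in_setI !mem_setE !in_itv/= /clamp01.
have [tge0|] := leP 0 t => /=; last by case: ifP.
have tp : 0 < t by rewrite lt_neqAle eq_sym t0.
rewrite le_min le_max (leNgt t 0) tp/=.
by case: (t <= x) => //=; case: (t <= 1).
Qed.

Lemma kernel_cdfE w z :
  kernel_cdf w z = density_cdf (kernel_density w) z%:num.
Proof.
by apply/val_inj => /=; rewrite -[RHS]ext01_kernel_cdf /ext01 -/(proj01 _) proj01K.
Qed.

Lemma is_derivative01_kernel_cdf w : is_derivative01 (kernel_cdf w) w.
Proof.
apply/ae_lebesgue01.
have := mk_pdfE (is_pdf_kernel_density w).
have := is_derive_density_cdf (kernel_density w).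
apply: filterS2; first exact: (ae_filter_ringOfSetsType mu).
move=> x + /(_ Logic.I) kx x01.
rewrite -/(kernel_density w) in kx.
rewrite kx patchE mem_setE x01.
by rewrite (_ : ext01 _ = fun y => (density_cdf (kernel_density w) y)%:num)//;
  apply/funext => y; exact: ext01_kernel_cdf.
Qed.

Lemma is_derivative01_unique (a : I -> I) (u v : kernel01 R) :
  is_derivative01 a u -> is_derivative01 a v -> u = v.
Proof.
move=> au av; apply/pdf_eqP; move: au av.
apply: filterS2; first exact: (ae_filter_ringOfSetsType mu01).
move=> x ux vx _.
by rewrite -(@derive_val _ _ _ _ _ _ _ ux) (@derive_val _ _ _ _ _ _ _ vx).
Qed.

Lemma kernel_cdf_inj : injective (@kernel_cdf R).
Proof.
move=> v w vw; apply: (@is_derivative01_unique (kernel_cdf w)).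
  by rewrite -vw; exact: is_derivative01_kernel_cdf.
exact: is_derivative01_kernel_cdf.
Qed.

(** A density whose distribution function goes from 0 to 1 on [0, 1] puts all
    its mass there, so it represents a kernel. *)
Lemma exists_kernel_of_density (f : densityR R) :
  (density_cdf f 0)%:num = 0 -> (density_cdf f 1)%:num = 1 ->
  exists w : kernel01 R, forall z, kernel_cdf w z = density_cdf f z%:num.
Proof.
move=> F0 F1; have [mf f0 _] := pdfP f; have fi := is_pdf_integrable (pdfP f).
have FB (z : R) : 0 <= z -> \int[mu]_(t in `[0, z]) f t = (density_cdf f z)%:num.
  move=> z0; rewrite -Rintegral_itv_obnd_cbnd; last exact: integrableS fi.
  rewrite -(@Rintegral_itvB _ f -oo%O (BRight z) 0)//; last exact: integrableS fi.
  by rewrite [X in _ - X](_ : _ = (density_cdf f 0)%:num)// F0 subr0.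
have fp : is_pdf mu01 f.
  split => //.
    apply/ae_lebesgue01; move: f0.
    by apply: filterS => x.
  rewrite integral_lebesgue01//; last exact/measurable_EFinP.
  rewrite setTI -[LHS]fineK; last first.
    by apply: integrable_fin_num => //; exact: integrableS fi.
  have I1 := congr1 EFin (etrans (FB 1 ler01) F1); exact: I1.
exists (mk_pdf fp) => z; apply/val_inj => /=.
rewrite (ae_eq_Rintegral _ _ _ (mk_pdfE fp)) //=; last first.
  by have [] := pdfP (mk_pdf fp).
rewrite -[RHS]FB// /Rintegral integral_lebesgue01//; last exact/measurable_EFinP.
congr (fine (integral _ _ _)); apply/seteqP; split => [t []//|t /=].
rewrite !in_itv/= => /andP[t0 tz]; rewrite t0 tz; split => //=.
exact: le_trans tz _.
Qed.

End kernels.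

(** * Absolutely continuous surjections of [0, 1] *)

Section absolute_continuity.
Variable R : realType.
Local Notation I := {i01 R}.
Local Notation mu := (@lebesgue_measure R).

Lemma density_cdf_homo (f : densityR R) : {homo density_cdf f : x y / x <= y}.
Proof.
move=> x y xy; have fp := pdfP f; have [mf _ _] := fp.
have [g [gp g0 fg]] := is_pdf_nneg fp; have [mg _ g1] := gp.
change ((density_cdf f x)%:num <= (density_cdf f y)%:num).
have Fg t : (density_cdf f t)%:num = cdf_fun g t by exact: ae_eq_Rintegral fg.
by rewrite !Fg; apply: cdf_fun_homo => //; exact: is_pdf_integrable.
Qed.

Lemma density_cdfB (f : densityR R) x y : x <= y ->
  (density_cdf f y)%:num - (density_cdf f x)%:num = \int[mu]_(t in `]x, y]) f t.
Proof.
move=> xy; rewrite -(@Rintegral_itvB _ f -oo%O (BRight y) x)//.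
by apply: integrableS (is_pdf_integrable (pdfP f)).
Qed.

(** Absolute continuity of the integral, applied to the union of the disjoint
    intervals. *)
Lemma density_cdf_abs_continuous (f : densityR R) (e : R) : 0 < e ->
  exists2 d : R, 0 < d & forall (n : nat) (x y : 'I_n -> R),
    (forall i, x i <= y i) ->
    (forall i j, i != j -> (y i <= x j) || (y j <= x i)) ->
    \sum_(i < n) (y i - x i) < d ->
    \sum_(i < n) `|(density_cdf f (y i))%:num - (density_cdf f (x i))%:num| < e.
Proof.
move=> e0; have fi := is_pdf_integrable (pdfP f).
have mf : measurable_fun setT f by have [] := pdfP f.
have [d [d0 hd]] := integral_normr_continuous fi e0.
exists d => // n x y xy dxy sd.
pose A i := `](x i), (y i)]%classic : set (measurableTypeR R).
have mA i : measurable (A i) by exact: measurable_itv.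
have tA : trivIset setT A.
  apply/trivIsetP => i j _ _ /dxy yx; apply/seteqP; split=> // t [].
  rewrite /A /= !in_itv/= => /andP[xit tyi] /andP[xjt tyj].
  case/orP: yx => [yx|yx].
    by have := le_lt_trans (le_trans tyi yx) xjt; rewrite ltxx.
  by have := le_lt_trans (le_trans tyj yx) xit; rewrite ltxx.
have mAA : measurable (\big[setU/set0]_(i < n) A i) by exact: bigsetU_measurable.
apply: le_lt_trans (hd _ mAA _); last first.
  rewrite measure_bigsetU_ord// (eq_bigr (fun i => (y i - x i)%:E)) ?sumEFin ?lte_fin//.
  move=> i _; rewrite [LHS](lebesgue_measure_itv `](x i), (y i)])/= lte_fin.
  have := xy i; rewrite le_eqVlt => /predU1P[->|->]; last by rewrite EFinB.
  by rewrite ltxx subrr.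
have fA i : mu.-integrable (A i) (EFin \o f) by exact: integrableS fi.
have ifin i : (\int[mu]_(t in A i) `|f t|%:E)%E \is a fin_num.
  by apply: integrable_fin_num => //; exact: (integrable_norm (fA i)).
rewrite -lee_fin /Rintegral (ge0_integral_bigsetU mu mA (index_enum_uniq _))//; last 2 first.
- exact: sub_trivIset tA.
- by apply: measurable_funTS; apply/measurable_EFinP;
     exact: (measurableT_comp (@normr_measurable R setT)).
rewrite fineK; last by apply/sum_fin_numP => i _ _.
rewrite -sumEFin; apply: lee_sum => i _.
rewrite density_cdfB// -[leRHS]fineK// lee_fin.
exact: (le_normr_Rintegral (mA i) (fA i)).
Qed.

Lemma kernel_cdf_abs_continuous (w : kernel01 R) : abs_continuous01 (kernel_cdf w).
Proof.
move=> e /(density_cdf_abs_continuous (kernel_density w))[d d0 hd].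
exists d => // n x y xy dxy sd; under eq_bigr do rewrite !kernel_cdfE.
exact: (hd n (fun i => (x i)%:num) (fun i => (y i)%:num)).
Qed.

Lemma clamp01B (x y : R) : x <= y -> clamp01 y - clamp01 x <= y - x.
Proof.
move=> xy; rewrite /clamp01.
case: (leP (Num.max 0 x) 1); case: (leP (Num.max 0 y) 1);
  case: (leP 0 x) => ?; case: (leP 0 y) => ? ? ?; lra.
Qed.

Lemma ext01_small_increment (a : I -> I) (e : R) : abs_continuous01 a -> 0 < e ->
  exists2 d : R, 0 < d &
    forall (x y : R), x <= y -> y - x < d -> ext01 a y - ext01 a x < e.
Proof.
move=> aca e0; have [d d0 hd] := aca e e0; exists d => // x y xy yxd.
have pxy := proj01_homo xy.
have := hd 1%N (fun=> proj01 x) (fun=> proj01 y); rewrite !big_ord1.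
move=> H; apply: le_lt_trans (ler_norm _) (H _ _ _) => //.
- by move=> i j; rewrite !ord1 eqxx.
- by apply: le_lt_trans yxd; exact: clamp01B.
Qed.

Lemma continuous_ext01 (a : I -> I) : abs_continuous01 a ->
  {homo a : x y / x <= y} -> continuous (ext01 a).
Proof.
move=> aca amono x; apply/cvgrPdist_lt => e e0.
have [d d0 hd] := ext01_small_increment aca e0.
have emono s t : s <= t -> ext01 a s <= ext01 a t.
  by move=> st; apply: amono; exact: proj01_homo.
near=> y.
have xyd : `|x - y| < d by near: y; exact: cvgr_dist_lt.
have [xy|/ltW yx] := leP x y.
  rewrite distrC ger0_norm ?subr_ge0 ?emono// hd//.
  by apply: le_lt_trans xyd; rewrite distrC ler_norm.
rewrite ger0_norm ?subr_ge0 ?emono// hd//.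
by apply: le_lt_trans xyd; rewrite ler_norm.
Unshelve. all: by end_near. Qed.

Lemma ext01_num (a : I -> I) (z : I) : ext01 a z%:num = (a z)%:num.
Proof. by rewrite /ext01 -/(proj01 _) proj01K. Qed.

(** Surjectivity comes from the intermediate value theorem. *)
Lemma ac_surjections_ends (a : I -> I) : abs_continuous01 a ->
  {homo a : x y / x <= y} ->
  ext01 a 0 = 0 -> ext01 a 1 = 1 -> ac_surjections a.
Proof.
move=> aca amono a0 a1; split => // y.
have [||c c01 cy] := @IVT _ (ext01 a) 0 1 y%:num ler01.
- by apply: continuous_subspaceT; exact: continuous_ext01.
- by rewrite a0 a1 (min_idPl ler01) (max_idPr ler01) ge0 le1.
- by exists (proj01 c); apply/val_inj; rewrite /= -cy.
Qed.

Lemma ac_surjections_ext01_0 (a : I -> I) : ac_surjections a -> ext01 a 0 = 0.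
Proof.
move=> [_ amono asurj]; have [z az] := asurj (proj01 0).
apply/eqP; rewrite eq_le (ge0 (a _)) andbT.
rewrite -[leRHS](proj01_le0 (lexx 0)) -az; apply: amono.
by change (clamp01 0 <= z%:num); rewrite [leLHS](proj01_le0 (lexx 0)).
Qed.

Lemma ac_surjections_ext01_1 (a : I -> I) : ac_surjections a -> ext01 a 1 = 1.
Proof.
move=> [_ amono asurj]; have [z az] := asurj (proj01 1).
apply/eqP; rewrite eq_le (le1 (a _)) /=.
rewrite -[leLHS](proj01_ge1 (lexx 1)) -az; apply: amono.
by change (z%:num <= clamp01 1); rewrite [leRHS](proj01_ge1 (lexx 1)).
Qed.

Lemma submonoid_ac_surjections : submonoid (@ac_surjections R).
Proof.
split.
  split => //; last by move=> y; exists y.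
  move=> e e0; exists e => // n x y xy _; apply: le_lt_trans.
  by apply: ler_sum => i _; rewrite ger0_norm// subr_ge0; exact: xy.
move=> a b [aca amono asurj] [acb bmono bsurj]; split.
- move=> e /aca[d d0 hd]; have [d' d'0 hd'] := acb d d0; exists d' => // n x y xy dxy sd.
  apply: hd => [i|i j /dxy/orP[]|].
  + exact: bmono.
  + by move/bmono => ->.
  + by move/bmono => ->; rewrite orbT.
  + apply: le_lt_trans (hd' n x y xy dxy sd); apply: ler_sum => i _.
    exact: ler_norm.
- by move=> x y xy; apply/amono/bmono.
- by move=> y; have [z <-] := asurj y; have [t <-] := bsurj z; exists t.
Qed.

Lemma kernel_cdf_ac_surjection (w : kernel01 R) : ac_surjections (kernel_cdf w).
Proof.
apply: ac_surjections_ends.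
- exact: kernel_cdf_abs_continuous.
- move=> x y xy; rewrite !kernel_cdfE.
  by apply: density_cdf_homo.
- have [mw _ _] := pdfP w; have mwE := (measurable_EFinP _ _).2 mw.
  rewrite /ext01 /= -[clamp01 0]/((proj01 0)%:num) proj01_le0// set_itv1.
  rewrite /Rintegral integral_lebesgue01// setIidl ?integral_set1//.
  by move=> _ ->; rewrite /= in_itv/= lexx ler01.
- rewrite /ext01 /= -[clamp01 1]/((proj01 1)%:num) proj01_ge1//.
  have [mw _ w1] := pdfP w; have mwE := (measurable_EFinP _ _).2 mw.
  rewrite /Rintegral integral_lebesgue01// setIid.
  by rewrite -[`[0, 1]%classic]setTI -integral_lebesgue01// w1.
Qed.
End absolute_continuity.

(** * Every absolutely continuous surjection is a primitive of a kernel *)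

Section onto.
Variable R : realType.
Local Notation I := {i01 R}.
Local Notation mu := (@lebesgue_measure R).

(** The half-open hull is the form in which a Stieltjes measure is known;
    openness is what keeps the left endpoint out of [Q]. *)
Lemma open_interval_bounds (Q : set R) : open Q -> is_interval Q ->
  (mu Q < +oo)%E -> Q !=set0 ->
  exists x y : R, [/\ Q `<=` `]x, y], `]x, y[ `<=` Q & ((y - x)%:E <= mu Q)%E].
Proof.
move=> oQ /is_intervalP; move: (Rhull Q) => i Qi; rewrite {}Qi in oQ *.
have nolow (x : R) : [set` i] x -> exists2 t, t < x & [set` i] t.
  move: oQ; rewrite openE => /[apply] /nbhs_ballP[e /= e0 sub].
  exists (x - e / 2); first by rewrite ltrBlDr ltrDl divr_gt0.
  apply: sub; rewrite /ball /= opprB addrCA subrr addr0 gtr0_norm ?divr_gt0//.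
  by rewrite ltr_pdivrMr// ltr_pMr// ltr1n.
rewrite lebesgue_measure_itv; case: i {oQ} nolow => [[b1 x|[]] [b2 y|[]]] //= nolow.
- have bd s : [set` Interval (BSide b1 x) (BSide b2 y)] s -> x <= s /\ s <= y.
    rewrite /= in_itv => /andP[xs sy]; split.
      by case: (b1) xs => //= /ltW.
    by case: (b2) sy => //= /ltW.
  move=> _ [t /bd[xt ty]]; have xy := le_trans xt ty; exists x, y; split.
  + move=> s sQ /=; rewrite in_itv/= (bd _ sQ).2 andbT.
    by have [u us /bd[xu _]] := nolow _ sQ; exact: le_lt_trans us.
  + by apply: subset_itv; rewrite bnd_simp; case: (b1) (b2) => [] [].
  + move: xy; rewrite lte_fin le_eqVlt => /predU1P[->|->]; last by rewrite EFinB.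
    by rewrite ltxx subrr.
- by move=> _ [t]; rewrite /= in_itv/= andbF.
- by rewrite ltry addye// ltxx.
- by rewrite ltNyr addey// ltxx.
- by move=> _ [t].
- by move=> _ [t].
- by move=> _ [t].
- by move=> _ [t].
Qed.

(** Outer regularity covers a null set by an open set of measure less than [d],
    a disjoint union of open intervals. The increments of [a] over finitely many
    of these sum to less than [e], hence the Stieltjes measure [P] of the open
    set is at most [e]. *)
Lemma abs_continuous01_null_dominates (a : I -> I)
    (P : {measure set (measurableTypeR R) -> \bar R}) :
  abs_continuous01 a ->
  (forall x y, x <= y -> P `]x, y]%classic = (ext01 a y - ext01 a x)%:E) ->
  P `<< mu.
Proof.
move=> aca PE; apply/null_content_dominatesP => A mA A0.
apply/eqP; rewrite eq_le measure_ge0 andbT; apply/lee_addgt0Pr => e e0.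
rewrite add0e; have [d d0 hd] := aca e e0.
have [|U [oU AU UA]] := lebesgue_regularity_outer mA _ d0; first by rewrite A0.
have mU : measurable U by exact: open_measurable.
have Ud : (mu U < d%:E)%E.
  rewrite -(setDUK AU) (le_lt_trans (measureU2 _ _ _))//; first exact: measurableD.
  by rewrite A0 add0e.
apply: (@le_trans _ _ (P U)); first by rewrite le_measure ?inE.
pose Q := open_disjoint_itv oU.
have mQ n : measurable (Q n) by apply: open_measurable; exact: open_disjoint_itv_open.
have tQ : trivIset setT Q by exact: open_disjoint_itv_trivIset.
have QU n : Q n `<=` U.
  by rewrite [X in _ `<=` X](open_disjoint_itv_bigcup oU) => t Qt; exists n.
(* Empty members get the endpoints 0, 0: once clamped to [0, 1], no other
   interval starts to the left of that point, so that the disjointness condition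
   in the definition of absolute continuity holds. *)
have xyP n : exists xy : R * R, [/\ xy.1 <= xy.2, Q n `<=` `]xy.1, xy.2],
    ((xy.2 - xy.1)%:E <= mu (Q n))%E &
    `]xy.1, xy.2[ `<=` Q n /\ (Q n = set0 -> xy = (0, 0))].
  have [Qn|/set0P Qn] := eqVneq (Q n) set0.
    exists (0, 0); rewrite Qn measure0 subrr; split => //=.
    by split => // t /=; rewrite in_itv/= => /andP[/lt_trans + /[dup]] => /[apply]; rewrite ltxx.
  have [||||x [y [Qxy xyQ yx]]] := @open_interval_bounds (Q n).
  - exact: open_disjoint_itv_open.
  - exact: open_disjoint_itv_is_interval.
  - apply: le_lt_trans (lt_trans Ud (ltry _)).
    by rewrite le_measure ?inE//; exact: mQ.
  - exact: Qn.
  - exists (x, y); split => //=; last by split => // Q0; case: Qn => t; rewrite Q0 => -[].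
    case: Qn => t /Qxy; rewrite /= in_itv/= => /andP[/ltW]; exact: le_trans.
have [xy hxy] := choice xyP.
have {1}-> : U = \bigcup_n Q n by exact: open_disjoint_itv_bigcup.
rewrite measure_semi_bigcup//; last exact: bigcupT_measurable.
apply: lime_le; first exact: is_cvg_nneseries.
apply: nearW => n; rewrite big_mkord.
pose x (i : 'I_n) := proj01 (xy i).1; pose y (i : 'I_n) := proj01 (xy i).2.
apply: (@le_trans _ _ (\sum_(i < n) `|(a (y i))%:num - (a (x i))%:num|)%:E).
  rewrite -sumEFin; apply: lee_sum => i _; have [xyi Qxy _ _] := hxy i.
  apply: (@le_trans _ _ (P `](xy i).1, (xy i).2]%classic)).
    apply: le_measure; rewrite ?inE//; exact: mQ.
  by rewrite PE// lee_fin ler_norm.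
rewrite lee_fin ltW//; apply: hd.
- by move=> i; apply: proj01_homo; have [] := hxy i.
- move=> i j ij; have [xyi Qxyi _ [Qi Q0i]] := hxy i; have [xyj Qxyj _ [Qj Q0j]] := hxy j.
  have p0 t : proj01 0 <= proj01 t.
    by change (clamp01 0 <= clamp01 t); rewrite [leLHS](proj01_le0 (lexx 0)) clamp01_ge0.
  have [/Q0i xy0|/set0P Qin] := eqVneq (Q i) set0; first by rewrite /y xy0 p0.
  have [/Q0j xy0|/set0P Qjn] := eqVneq (Q j) set0.
    by rewrite [X in _ || X](_ : _ = true) ?orbT// /y xy0 p0.
  have [ij'|ji] := leP (xy i).2 (xy j).1; first by rewrite [y i <= _]proj01_homo.
  have [ji'|ij'] := leP (xy j).2 (xy i).1; first by rewrite [y j <= _]proj01_homo// orbT.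
  have {Qin} xyi' : (xy i).1 < (xy i).2.
    have [t /Qxyi] := Qin; rewrite /= in_itv/= => /andP[]; exact: lt_le_trans.
  have {Qjn} xyj' : (xy j).1 < (xy j).2.
    have [t /Qxyj] := Qjn; rewrite /= in_itv/= => /andP[]; exact: lt_le_trans.
  (* Otherwise the two intervals overlap, and the midpoint of the overlap is in
     both. *)
  have xy_lt : Num.max (xy i).1 (xy j).1 < Num.min (xy i).2 (xy j).2.
    by rewrite gt_max !lt_min xyi' xyj' ij' ji.
  have [] := midf_lt xy_lt; set m := _ / _.
  rewrite gt_max lt_min => /andP[m1 m3] /andP[m2 m4].
  have := tQ i j Logic.I Logic.I.
  move=> /(_ _)/val_inj ijE; case/eqP: ij; apply: ijE; exists m; split.
    by apply: Qi; rewrite /= in_itv/= m1.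
  by apply: Qj; rewrite /= in_itv/= m3.
- rewrite -lte_fin (le_lt_trans _ Ud)// -sumEFin.
  rewrite (@le_trans _ _ (\sum_(i < n) mu (Q i))%E)//.
    apply: lee_sum => i _; have [xyi _ yx _] := hxy i.
    by apply: le_trans yx; rewrite lee_fin; exact: clamp01B.
  have <- : mu (\big[setU/set0]_(i < n) Q i) = (\sum_(i < n) mu (Q i))%E.
    exact: measure_bigsetU.
  rewrite le_measure ?inE//; first by apply: bigsetU_measurable => i _; exact: mQ.
  rewrite [X in _ `<=` X](open_disjoint_itv_bigcup oU).
  exact: bigsetU_bigcup.
Qed.


(** The constant extension of [a] to the line is a cumulative distribution
    function; the kernel is the density of its Stieltjes probability. *)
Lemma kernel_cdf_onto (a : I -> I) : ac_surjections a ->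
  exists w : kernel01 R, kernel_cdf w = a.
Proof.
move=> sa; have [aca amono _] := sa.
have a0 := ac_surjections_ext01_0 sa; have a1 := ac_surjections_ext01_1 sa.
have emono : {homo ext01 a : x y / x <= y} by move=> x y xy; exact/amono/proj01_homo.
have erc : right_continuous (ext01 a).
  by apply: right_continuousW; exact: continuous_ext01.
have eNy : ext01 a @ -oo --> (0 : R).
  apply: cvg_near_cst; exists 0; split => // x /ltW x0.
  rewrite -[RHS]a0; congr (a _)%:num; apply/val_inj.
  exact: etrans (proj01_le0 x0) (esym (proj01_le0 (lexx 0))).
have ey : ext01 a @ +oo --> (1 : R).
  apply: cvg_near_cst; exists 1; split => // x /ltW x1.
  rewrite -[RHS]a1; congr (a _)%:num; apply/val_inj.
  exact: etrans (proj01_ge1 x1) (esym (proj01_ge1 (lexx 1))).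
pose F : cumulativeBounded (0 : R) (1 : R) := HB.pack (ext01 a)
  (isCumulative.Build R _ R (ext01 a) emono erc)
  (isCumulativeBounded.Build R 0 1 (ext01 a) eNy ey).
pose P : probability _ R := lebesgue_stieltjes_measure F.
have PNy x : P `]-oo, x]%classic = (ext01 a x)%:E.
  by rewrite -(cdf_lebesgue_stieltjes_id F x).
have Pdom : P `<< mu.
  apply: (abs_continuous01_null_dominates aca) => x y xy.
  rewrite /P /= /lebesgue_stieltjes_measure /measure_extension.
  by rewrite measurable_mu_extE/= ?wlength_itv_bnd//; exact: is_ocitv.
pose r := Radon_Nikodym_SigmaFinite.f P mu.
have rE A : measurable A -> P A = (\int[mu]_(x in A) r x)%E.
  exact: Radon_Nikodym_SigmaFinite.f_integral.
have rfin x : (fine (r x))%:E = r x.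
  by rewrite fineK//; exact: Radon_Nikodym_SigmaFinite.f_fin_num.
have mr : measurable_fun setT (fine \o r : measurableTypeR R -> R).
  apply: measurableT_comp => //.
  exact: (measurable_int _ (Radon_Nikodym_SigmaFinite.f_integrable Pdom)).
have rp : is_pdf mu (fine \o r).
  split => //.
    by apply: aeW => x; rewrite fine_ge0//; exact: Radon_Nikodym_SigmaFinite.f_ge0.
  under eq_integral do rewrite /= rfin.
  by rewrite -rE// probability_setT.
have mkr : measurable_fun setT (mk_pdf rp) by have [] := pdfP (mk_pdf rp).
have cdfE x : (density_cdf (mk_pdf rp) x)%:num = ext01 a x.
  apply: EFin_inj; rewrite -PNy rE//= (ae_eq_Rintegral _ _ _ (mk_pdfE rp))//.
  rewrite /Rintegral.
  under eq_integral do rewrite /= rfin.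
  by rewrite -rE// fineK// PNy.
have [w wE] := @exists_kernel_of_density _ (mk_pdf rp) (etrans (cdfE 0) a0) (etrans (cdfE 1) a1).
exists w; apply/funext => z; rewrite wE; apply/val_inj.
by rewrite /= -[LHS]/((density_cdf (mk_pdf rp) z%:num)%:num) cdfE ext01_num.
Qed.
End onto.

(** * The monoid of derangetropy operators *)

Section derangetropy_operators.
Variable R : realType.
Local Notation I := {i01 R}.
Local Notation mu := (@lebesgue_measure R).
Local Notation mu01 := (@lebesgue01 R).

(** Both sides send a density with distribution function [F] to one with
    distribution function [A_v \o A_w \o F]. *)
Lemma comp_derangetropy (u v w : kernel01 R) :
  kernel_cdf u = kernel_cdf v \o kernel_cdf w ->
  derangetropy v \o derangetropy w = derangetropy u.
Proof.
move=> uvw; apply/funext => f; apply: density_cdf_inj; apply/funext => x /=.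
by rewrite !density_cdf_derangetropy uvw.
Qed.

Lemma exists_comp_kernel (v w : kernel01 R) :
  exists u : kernel01 R, kernel_cdf u = kernel_cdf v \o kernel_cdf w.
Proof.
apply: kernel_cdf_onto; apply: (submonoid_ac_surjections R).2;
  exact: kernel_cdf_ac_surjection.
Qed.

Lemma exists_id_kernel : exists w : kernel01 R, kernel_cdf w = id.
Proof. exact: kernel_cdf_onto (submonoid_ac_surjections R).1. Qed.

Lemma derangetropy_id (w : kernel01 R) : kernel_cdf w = id -> derangetropy w = id.
Proof.
move=> w1; apply/funext => f; apply: density_cdf_inj; apply/funext => x.
by rewrite density_cdf_derangetropy w1.
Qed.

(** The extension by zero of the kernel whose primitive is the identity. *)
Lemma exists_uniform_density :
  exists f : densityR R, forall z : I, density_cdf f z%:num = z.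
Proof.
have [w w1] := exists_id_kernel.
by exists (kernel_density w) => z; rewrite -kernel_cdfE w1.
Qed.

(** The isomorphism sends an operator to the distribution function of the image
    of the uniform density, a formula that does not refer to a kernel; this is
    why it is well defined. *)
Lemma derangetropy_monoid_iso :
  exists2 Phi : (densityR R -> densityR R) -> (I -> I),
    (forall w, Phi (derangetropy w) = kernel_cdf w) &
    monoid_iso (range (@derangetropy R)) (@ac_surjections R) Phi.
Proof.
have [f fz] := exists_uniform_density.
pose Phi (T : densityR R -> densityR R) (z : I) : I := density_cdf (T f) z%:num.
have PhiE w : Phi (derangetropy w) = kernel_cdf w.
  by apply/funext => z; rewrite /Phi density_cdf_derangetropy fz.
exists Phi => //; split.
- split.
    have [w w1] := exists_id_kernel.
    by exists w => //; exact: derangetropy_id.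
  move=> _ _ [v _ <-] [w _ <-]; have [u uvw] := exists_comp_kernel v w.
  by exists u => //; rewrite (comp_derangetropy uvw).
- exact: submonoid_ac_surjections.
- split.
  + by move=> _ [w _ <-]; rewrite PhiE; exact: kernel_cdf_ac_surjection.
  + move=> _ _ /set_mem[v _ <-] /set_mem[w _ <-].
    by rewrite !PhiE => /kernel_cdf_inj ->.
  + move=> a /kernel_cdf_onto[w <-].
    by exists (derangetropy w); [exists w|exact: PhiE].
- by apply/funext => z; exact: fz.
- move=> _ _ [v _ <-] [w _ <-]; have [u uvw] := exists_comp_kernel v w.
  by rewrite (comp_derangetropy uvw) !PhiE.
Qed.

Lemma exists_iter_kernel (w : kernel01 R) (n : nat) :
  exists u : kernel01 R, kernel_cdf u = iter n (kernel_cdf w) /\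
    iter n (derangetropy w) = derangetropy u.
Proof.
elim: n => [|n [u [un rn]]].
  have [u u1] := exists_id_kernel; exists u; split; first exact: u1.
  by apply/esym; exact: derangetropy_id.
have [t tE] := exists_comp_kernel w u; exists t; split.
  by rewrite tE un; exact: funext.
rewrite -(comp_derangetropy tE) -rn; exact: funext.
Qed.

Lemma density_cdf_iter_derangetropy (w : kernel01 R) (f : densityR R) n x :
  density_cdf (iter n (derangetropy w) f) x =
  iter n (kernel_cdf w) (density_cdf f x).
Proof. by elim: n => //= n IH; rewrite density_cdf_derangetropy IH. Qed.

(** The step from [n] to [n + 1] multiplies by [w] at the distribution function
    of the [n]-th iterate, which is [iter n A_w] composed with that of [f]. *)
Lemma iter_derangetropy_prod (w : kernel01 R) (f : densityR R) (w0 f0 : R -> R) n :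
  w = w0 %[ae mu01] -> f = f0 %[ae mu] ->
  iter n (derangetropy w) f = (fun x => f0 x * \prod_(0 <= j < n)
    w0 (iter j (kernel_cdf w) (density_cdf f x))%:num) %[ae mu].
Proof.
move=> ww0 ff0; elim: n => [|n IH].
  by apply: filterS ff0 => x /(_ Logic.I) fx _; rewrite big_geq// mulr1.
apply: filterS (derangetropyE ww0 IH) => x /(_ Logic.I) -> _.
by rewrite density_cdf_iter_derangetropy big_nat_recr//= mulrCA [X in _ * X]mulrC.
Qed.

Lemma derangetropy_derive1 (a : I -> I) (u : kernel01 R) (f : densityR R)
    (f0 : R -> R) : is_derivative01 a u -> f = f0 %[ae mu] ->
  derangetropy u f =
    (fun x => derive1 (ext01 a) (density_cdf f x)%:num * f0 x) %[ae mu].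
Proof.
move=> au; apply: derangetropyE; move: au.
apply: filterS; first exact: (ae_filter_ringOfSetsType mu01).
by move=> z uz _; rewrite derive1E (@derive_val _ _ _ _ _ _ _ uz).
Qed.

End derangetropy_operators.

Theorem theorem3 (R : realType) :
  [/\ forall v w : kernel01 R, exists2 u : kernel01 R,
        is_derivative01 (kernel_cdf v \o kernel_cdf w) u &
        derangetropy v \o derangetropy w = derangetropy u,
      exists2 Phi : (densityR R -> densityR R) -> ({i01 R} -> {i01 R}),
        (forall w, Phi (derangetropy w) = kernel_cdf w) &
        monoid_iso (range (@derangetropy R)) (@ac_surjections R) Phi &
      forall (w : kernel01 R) (n : nat), (1 <= n)%N ->
        exists u : kernel01 R,
        [/\ is_derivative01 (iter n (kernel_cdf w)) u,
            iter n (derangetropy w) = derangetropy u &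
            forall (f : densityR R) (w0 f0 : R -> R),
              w = w0 %[ae lebesgue01 R] -> f = f0 %[ae lebesgue_measure] ->
              iter n (derangetropy w) f =
                (fun x => derive1 (ext01 (iter n (kernel_cdf w))) (density_cdf f x)%:num
                          * f0 x) %[ae lebesgue_measure] /\
              iter n (derangetropy w) f =
                (fun x => f0 x * \prod_(0 <= j < n)
                   w0 (iter j (kernel_cdf w) (density_cdf f x))%:num)
                %[ae lebesgue_measure]]].
Proof.
split.
- move=> v w; have [u uvw] := exists_comp_kernel v w; exists u.
    by rewrite -uvw; exact: is_derivative01_kernel_cdf.
  exact: comp_derangetropy.
- exact: derangetropy_monoid_iso.
- move=> w n _; have [u [un rn]] := exists_iter_kernel w n; exists u.
  have du : is_derivative01 (iter n (kernel_cdf w)) u.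
    by rewrite -un; exact: is_derivative01_kernel_cdf.
  split => // f w0 f0 ww0 ff0; split; last exact: iter_derangetropy_prod.
  by rewrite rn; exact: derangetropy_derive1.
Qed.
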